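(* Let $G$ be a finite group of order $n$. Then $\eta(G)\le\tau(n)$, with equality if and only if $G\cong\mathbb{Z}_n$.
   Context: For a finite group $G$, $\omega(G)$ denotes the set of orders of elements of $G$ and $\eta(G)=|\omega(G)|$. $\tau(n)$ is the number of positive divisors of $n$, and $\mathbb{Z}_n$ is the cyclic group of order $n$. *)

(* Defs.v *)
From mathcomp Require Import all_boot all_fingroup all_solvable.
From mathcomp Require Import finmap.

Set Implicit Arguments.
Unset Strict Implicit.
Unset Printing Implicit Defensive.

Definition omega (gT : finGroupType) (G : {group gT}) : {fset nat} :=
  [fset #[x]%g | x in G]%fset.

Definition eta (gT : finGroupType) (G : {group gT}) : nat := #|` omega G|.

(* [divisors n] is duplicate-free and, for n > 0, lists all divisors of n. *)
Definition tau (n : nat) : nat := size (divisors n).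

(* Main.v *)
Require Import Defs.
From mathcomp Require Import all_boot all_fingroup all_algebra all_solvable.
From mathcomp Require Import finmap.

(** By Lagrange, element orders are divisors of [n], so [omega G] is a subset
    of the finite set of divisors of [n]; this gives the inequality. If the
    cardinals agree, the two sets agree, so the divisor [n] itself is the order
    of some element, which then generates [G]. Conversely, in a cyclic group
    generated by [x] each divisor [d] of [n] is the order of [x ^+ (n %/ d)].
    Both directions are [omega_full_cyclic]; it remains only to translate
    cyclicity into isomorphism with [Zp n]. *)

Set Implicit Arguments.
Unset Strict Implicit.

Lemma omegaP (gT : finGroupType) (G : {group gT}) (d : nat) :
  reflect (exists2 x, x \in G & #[x]%g = d) (d \in omega G).
Proof.
apply: (iffP (imfsetP _ _ _ _)) => [[x Gx ->] | [x Gx <-]]; by exists x.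
Qed.

Lemma card_fset_divisors (n : nat) : #|` [fset d in divisors n]%fset| = tau n.
Proof. by rewrite card_fseq undup_id ?divisors_uniq. Qed.

Lemma omega_sub_divisors (gT : finGroupType) (G : {group gT}) :
  (omega G `<=` [fset d in divisors #|G|])%fset.
Proof.
apply/fsubsetP => _ /omegaP[x Gx <-].
by rewrite !inE -dvdn_divisors ?cardG_gt0 // order_dvdG.
Qed.

(** The order [#|G|] divides itself, so some element has that order and its
    powers exhaust [G]. In the other direction a generator of [G] has order
    [#|G|], and suitable powers of it realize every smaller divisor. *)
Lemma omega_full_cyclic (gT : finGroupType) (G : {group gT}) :
  omega G = [fset d in divisors #|G|]%fset <-> cyclic G.
Proof.
split=> [eqG | /cyclicP[x defG]].
  have: #|G| \in omega G by rewrite eqG !inE divisors_id ?cardG_gt0.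
  case/omegaP=> x Gx ox; apply/cyclicP; exists x.
  by apply/esym/eqP; rewrite eqEcard cycle_subG Gx -ox leqnn.
apply/eqP; rewrite eqEfsubset omega_sub_divisors; apply/fsubsetP => d.
rewrite !inE -dvdn_divisors ?cardG_gt0 // => dvd_d_G.
have oG : #[x]%g = #|G| by rewrite defG.
apply/omegaP; exists (x ^+ (#|G| %/ d))%g; first by rewrite defG mem_cycle.
rewrite orderXdiv oG ?dvdn_div //.
by rewrite divnA // mulKn ?cardG_gt0.
Qed.

Lemma cyclic_isog_Zp (gT : finGroupType) (G : {group gT}) :
  cyclic G <-> G \isog Zp #|G|.
Proof.
split=> [/cyclicP[x ->] | isoG]; first exact: isog_symr (Zp_isog x).
rewrite (@isog_cyclic _ _ G (Zp_group #|G|) isoG) /= /Zp; case: ifP => _; last exact: cyclic1.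
by rewrite Zp_cycle cycle_cyclic.
Qed.

(* [Zp n] is the additive cyclic group of order n for every n > 0; unlike the
   full type 'Z_n, it is the trivial group when n = 1. *)
Theorem theorem4p1 (gT : finGroupType) (G : {group gT}) (n : nat)
    (oG : #|G| = n) :
  eta G <= tau n /\ (eta G = tau n <-> G \isog Zp n).
Proof.
rewrite -oG -card_fset_divisors /eta.
have sub := omega_sub_divisors G.
split; first exact: fsubset_leq_card.
rewrite -cyclic_isog_Zp -omega_full_cyclic.
split=> [eq_card | -> //].
by apply/eqP; rewrite eqEfcard sub eq_card leqnn.
Qed.
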